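(* Suppose that Assumption $(L)$-a.e. holds for the trajectory set $\mathcal{S}$ and that $f\in Q$ has maturity $n_f\in\mathbb{N}$, is bounded from below, and satisfies $\overline{\sigma}f<\infty$. Let $0\le j<n_f$. Then: (1) For every $\epsilon>0$ there are a null set $N_f$ and a non-anticipative sequence $(H_i)_{i=j,\ldots,n_f-1}$ of real-valued functions on $\mathcal{S}$ such that for every $S\in\mathcal{S}\setminus N_f$ $$f(S)\le(\overline{\sigma}_jf(S)+\epsilon)+\sum_{i=j}^{n_f-1}H_i(S)\Delta_iS.$$ (2) Conversely, if there are a $V\in Q$ with maturity $j$, a non-anticipative sequence $(H_i)_{i=j,\ldots,n_f-1}$ of real-valued functions on $\mathcal{S}$, and a null set $\tilde N_f$ such that for every $S\in\mathcal{S}\setminus\tilde N_f$ $$f(S)\le V(S_0,\ldots,S_j)+\sum_{i=j}^{n_f-1}H_i(S)\Delta_iS,$$ then $\overline{\sigma}_jf\le V$ a.e. (3) In particular, $\overline{\sigma}f$ equals the infimum of all $V\in\mathbb{R}$ for which there exists a non-anticipative sequence $(H_j)_{j=0,\ldots,n_f-1}$ of real-valued functions on $\mathcal{S}$ such that $V+\sum_{j=0}^{n_f-1}H_j(S)\Delta_jS\ge f(S)$ for a.e. $S\in\mathcal{S}$.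
   Context: Trajectories and nodes. Fix $s_0\in\mathbb{R}$ and a trajectory set $\mathcal{S}$, i.e. a set of real sequences $S=(S_i)_{i\ge 0}$ with $S_0=s_0$. For $S\in\mathcal{S}$ and $j\ge 0$ let $\mathcal{S}_{(S,j)}=\{\tilde S\in\mathcal{S}:\tilde S_i=S_i,\ 0\le i\le j\}$; the pair $(S,j)$ (identified with $\mathcal{S}_{(S,j)}$) is called a node. Write $\Delta_iS=S_{i+1}-S_i$. A family $(H_i)$ of functions on $\mathcal{S}$ is non-anticipative if, for each index $i$, $H_i(S)=H_i(\tilde S)$ whenever $S_k=\tilde S_k$ for $0\le k\le i$. Portfolios. $\mathcal{H}_{(S,j)}$ is the set of sequences $H=(H_i)_{i\ge j}$ of functions $H_i:\mathcal{S}_{(S,j)}\to\mathbb{R}$ such that $H_i(\tilde S)=H_i(\hat S)$ whenever $\tilde S_k=\hat S_k$ for $j\le k\le i$ (no measurability is required). For $V\in\mathbb{R}$, $H\in\mathcal{H}_{(S,j)}$, $n\ge j$, put $\Pi_{j,n}^{V,H}(\tilde S)=V+\sum_{i=j}^{n-1}H_i(\tilde S)\Delta_i\tilde S$ for $\tilde S\in\mathcal{S}_{(S,j)}$. $\mathcal{E}_{(S,j)}$ is the vector space of all functions $\Pi_{j,n}^{V,H}$ on $\mathcal{S}_{(S,j)}$ ($V\in\mathbb{R}$, $H\in\mathcal{H}_{(S,j)}$, $n$ an integer $\ge j$), and $\mathcal{E}_{(S,j)}^+$ is the set of its nonnegative elements. Operators. $Q$ is the set of all functions $\mathcal{S}\to[-\infty,\infty]$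 and $P$ the set of all functions $\mathcal{S}\to[0,\infty]$. A function $f\in Q$ has maturity $n$ if $f(S)=f(\tilde S)$ for all $S\in\mathcal{S}$, $\tilde S\in\mathcal{S}_{(S,n)}$; then one also writes $f(S_0,\ldots,S_n)$ for $f(S)$. Conventions: $0\cdot\infty=0$, $\infty+(-\infty)=\infty$, $u-v=u+(-v)$, $\inf\emptyset=\infty$. For $f\in P$, $\overline{I}_jf(S)$ is the infimum of all $\sum_{m\ge1}V^m$ for which there are $H^m\in\mathcal{H}_{(S,j)}$ with $\Pi_{j,n}^{V^m,H^m}\in\mathcal{E}^+_{(S,j)}$ for all $n\ge j$, $m\ge 1$, and $f\le\sum_{m\ge1}\liminf_{n\to\infty}\Pi_{j,n}^{V^m,H^m}$ on $\mathcal{S}_{(S,j)}$. Write $\overline{I}=\overline{I}_0$ (a constant). $E\subseteq\mathcal{S}$ is a null set if $\overline{I}(\mathbf{1}_E)=0$; a property holds a.e. if it fails only on a null set. For $f\in Q$, $\overline{\sigma}_jf(S)$ is the infimum of all $\sum_{m\ge0}V^m$ for which $f\le\sum_{m\ge0}f_m$ on $\mathcal{S}_{(S,j)}$, where $f_0=\Pi_{j,n_0}^{V^0,H^0}\in\mathcal{E}_{(S,j)}$ for some $n_0$ and, for $m\ge1$, $f_m=\liminf_{n\to\infty}\Pi_{j,n}^{V^m,H^m}$ with $\Pi_{j,n}^{V^m,H^m}\in\mathcal{E}^+_{(S,j)}$ for all $n\ge j$. Write $\overline{\sigma}=\overline{\sigma}_0$ (a constant). Property $(L_{(S,j)})$: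 whenever $f=\Pi_{j,n_f}^{V,H}\in\mathcal{E}_{(S,j)}$ and $f_m=\liminf_{n\to\infty}\Pi_{j,n}^{V^m,H^m}$ with $\Pi_{j,n}^{V^m,H^m}\in\mathcal{E}^+_{(S,j)}$ for all $n\ge j$, $m\ge1$, satisfy $f\le\sum_{m\ge1}f_m$ on $\mathcal{S}_{(S,j)}$, then $V\le\sum_{m\ge1}V^m$. Property $(L)$ is $(L_{(S,0)})$ (independent of $S$). Assumption $(L)$-a.e. means: $(L)$ holds, and $\{S\in\mathcal{S}:\exists j\ge0\text{ such that }(L_{(S,j)})\text{ fails}\}$ is a null set. *)

(* Defs.v *)
From HB Require Import structures.
From mathcomp Require Import all_boot all_order all_algebra.
From mathcomp Require Import all_classical all_reals all_analysis.

Set Implicit Arguments.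
Unset Strict Implicit.
Unset Printing Implicit Defensive.

Import Order.TTheory GRing.Theory Num.Theory.
Import numFieldNormedType.Exports.

Local Open Scope classical_set_scope.
Local Open Scope ring_scope.
Local Open Scope ereal_scope.

(* Functions on a trajectory set T (or on a node) are represented by total
   functions on all real sequences; every condition below only involves their
   values on T (or on the node).

   Every extended-real sum formed below has at most one kind of infinity as
   soon as the domain is nonempty (admissible portfolios are nonnegative, the
   other summands are real), so the convention chosen for +oo + -oo, which is
   -oo in the library, is irrelevant. *)

Section Trajectories.
Context {R : realType}.

Definition trajectory := nat -> R.

Implicit Types (S : trajectory) (T A E N : set trajectory) (i j k n m : nat).

Definition trajectory_set (s0 : R) T := forall S, T S -> S 0%N = s0.

Definition node T S j : set trajectory :=
  [set S' | T S' /\ forall i, (i <= j)%N -> S' i = S i].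

Definition increment i S : R := (S i.+1 - S i)%R.

(* The set denoted \mathcal{H}, over a node A at time j. *)
Definition portfolio A j (H : nat -> trajectory -> R) :=
  forall i, (j <= i)%N -> forall S S', A S -> A S' ->
    (forall k, (j <= k <= i)%N -> S k = S' k) -> H i S = H i S'.

(* (H_i) indexed by j <= i < n, each H_i being a function on the whole of T
   that depends on the entire past S_0, ..., S_i. *)
Definition non_anticipative T j n (H : nat -> trajectory -> R) :=
  forall i, (j <= i < n)%N -> forall S S', T S -> T S' ->
    (forall k, (k <= i)%N -> S k = S' k) -> H i S = H i S'.

Definition gains j n (H : nat -> trajectory -> R) S : R :=
  (\sum_(j <= i < n) H i S * increment i S)%R.

(* The portfolio value \Pi_{j,n}^{V,H}. *)
Definition wealth j n (V : R) (H : nat -> trajectory -> R) S : R :=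
  (V + gains j n H S)%R.

(* \mathcal{E} and \mathcal{E}^+, over a node A at time j. *)
Definition elementary A j : set (trajectory -> R) :=
  [set g | exists V H n, [/\ portfolio A j H, (j <= n)%N &
    forall S, A S -> g S = wealth j n V H S]].

Definition elementary_pos A j : set (trajectory -> R) :=
  [set g | elementary A j g /\ forall S, A S -> (0 <= g S)%R].

Definition admissible A j (V : R) (H : nat -> trajectory -> R) :=
  portfolio A j H /\
  forall n, (j <= n)%N -> elementary_pos A j (wealth j n V H).

Definition liminf_wealth j (V : R) (H : nat -> trajectory -> R) S : \bar R :=
  limn_einf (fun n => (wealth j n V H S)%:E).

(* The superhedging operators over a node A at time j.  In [Iop] only the
   indices m >= 1 of the families V and H are used; in [sigmaop] the index 0
   is the elementary summand f_0. *)
Definition Iop A j (f : trajectory -> \bar R) : \bar R :=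
  ereal_inf [set x | exists (V : nat -> R) (H : nat -> nat -> trajectory -> R),
    [/\ forall m, (1 <= m)%N -> admissible A j (V m) (H m),
        forall S, A S -> f S <= \sum_(1 <= m <oo) liminf_wealth j (V m) (H m) S
      & x = \sum_(1 <= m <oo) (V m)%:E]].

Definition sigmaop A j (f : trajectory -> \bar R) : \bar R :=
  ereal_inf [set x |
    exists (V : nat -> R) (H : nat -> nat -> trajectory -> R) (n0 : nat),
    [/\ portfolio A j (H 0%N) /\ (j <= n0)%N,
        forall m, (1 <= m)%N -> admissible A j (V m) (H m),
        forall S, A S ->
          f S <= (wealth j n0 (V 0%N) (H 0%N) S)%:E
                 + \sum_(1 <= m <oo) liminf_wealth j (V m) (H m) S
      & x = (V 0%N)%:E + \sum_(1 <= m <oo) (V m)%:E]].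

Definition Ibar T j f S : \bar R := Iop (node T S j) j f.
Definition sigmabar T j f S : \bar R := sigmaop (node T S j) j f.

(* The time-0 operators are constants: all trajectories in T share the same
   initial value, so that every node at time 0 is T itself (lemma [node0]). *)
Definition Ibar0 T f : \bar R := Iop T 0 f.
Definition sigmabar0 T f : \bar R := sigmaop T 0 f.

Lemma node0 s0 T S : trajectory_set s0 T -> T S -> node T S 0 = T.
Proof.
move=> Ts0 TS; apply/seteqP; split => [S' []//|S' TS']; split => // i.
by rewrite leqn0 => /eqP ->; rewrite (Ts0 _ TS) (Ts0 _ TS').
Qed.

Lemma Ibar_at0 s0 T f S : trajectory_set s0 T -> T S ->
  Ibar T 0 f S = Ibar0 T f.
Proof. by move=> Ts0 TS; rewrite /Ibar (node0 Ts0 TS). Qed.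

Lemma sigmabar_at0 s0 T f S : trajectory_set s0 T -> T S ->
  sigmabar T 0 f S = sigmabar0 T f.
Proof. by move=> Ts0 TS; rewrite /sigmabar (node0 Ts0 TS). Qed.

Definition super_null T E :=
  E `<=` T /\ Ibar0 T (fun S => (\1_E S)%:E) = 0.

Definition holds_ae T (P : trajectory -> Prop) :=
  super_null T [set S | T S /\ ~ P S].

(* The property (L), over a node A at time j. *)
Definition property_L A j :=
  forall (V0 : R) (H0 : nat -> trajectory -> R) (nf : nat)
         (V : nat -> R) (H : nat -> nat -> trajectory -> R),
    portfolio A j H0 -> (j <= nf)%N ->
    (forall m, (1 <= m)%N -> admissible A j (V m) (H m)) ->
    (forall S, A S ->
       (wealth j nf V0 H0 S)%:E
         <= \sum_(1 <= m <oo) liminf_wealth j (V m) (H m) S) ->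
    V0%:E <= \sum_(1 <= m <oo) (V m)%:E.

Definition assumption_L_ae T :=
  property_L T 0 /\
  super_null T [set S | T S /\ exists j, ~ property_L (node T S j) j].

Definition has_maturity T n (f : trajectory -> \bar R) :=
  forall S S', T S -> node T S n S' -> f S = f S'.

Definition bounded_below T (f : trajectory -> \bar R) :=
  exists c : R, forall S, T S -> c%:E <= f S.

End Trajectories.

Arguments trajectory R : clear implicits.

(* Main.v *)
Require Import Defs.
From HB Require Import structures.
From mathcomp Require Import all_boot all_order all_algebra.
From mathcomp Require Import all_classical all_reals all_analysis.
From mathcomp Require Import lra.

Import Order.TTheory GRing.Theory Num.Theory.
Import numFieldNormedType.Exports.

Local Open Scope classical_set_scope.
Local Open Scope ring_scope.
Local Open Scope ereal_scope.

(** A superhedge in the definition of [sigmaop] uses countably many admissible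
    portfolios, each traded up to infinity; the theorem says that, outside a
    null set, one portfolio traded up to the maturity does as well.

    Part (1).  On the node at time [j], choose a superhedge whose cost exceeds
    [sigmabar] by less than [eps]; the choice is a function of the node, hence
    non-anticipative.  Two reductions make it finite.  In time: where property
    (L) holds at the node reached at the maturity, the claim, which is constant
    on that node, is at most the total wealth accumulated up to that date
    ([property_L_bound]).  In number: it remains to sum infinitely many
    nonnegative wealths into the wealth of one portfolio.  At a node with both
    upward and downward moves, nonnegativity after either move bounds each
    position by a multiple of the current wealth ([position_le_wealth]), so if
    the wealths are summable then so are the positions, and by induction over
    time the wealths stay summable ([cvg_series_wealth]).  At a node whose
    moves all go in one direction, a nonzero move is a free gain which can be
    bought infinitely often, so it occurs only on a null set
    ([one_sided_super_null]); where the move vanishes the positions do not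
    affect the wealth.

    Part (2).  A null set can be covered at arbitrarily small cost by a family
    of portfolios paying [+oo] on it ([super_nullP]), and almost every node
    inherits such covers ([ae_cheaply_covered_node]): a cover bought at time 0
    restarts at a later node with its current wealth as cost, and that wealth
    is large only on a cheaply covered set.  Adding a cover to the given hedge
    makes it valid everywhere, at an arbitrarily small extra cost.

    Part (3) is (1) and (2) at time 0, where [sigmabar] is a constant which is
    finite by property (L), and where no almost sure statement is vacuous
    ([ae_inhabited]). *)

(** * Series of extended reals, and limits inferior *)

Section Series.
Set Implicit Arguments.
Unset Strict Implicit.
Context {R : realType}.
Implicit Types (u v : nat -> \bar R) (F : nat -> nat -> \bar R).

Lemma near_eq_limn_einf u v :
  (\forall n \near \oo, u n = v n) -> limn_einf u = limn_einf v.
Proof.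
move=> [N _ uv]; rewrite !limn_einf_lim.
have E : \forall n \near \oo, einfs v n = einfs u n.
  exists N => // n /= Nn; congr ereal_inf; apply/seteqP.
  by split => _ [m /= nm <-]; exists m => //; rewrite uv//= (leq_trans Nn).
apply: cvg_lim => //.
apply: cvg_trans (@is_cvg_einfs _ v); exact: (near_eq_cvg E).
Qed.

Lemma nneseries_from1 u : (forall m, (1 <= m)%N -> 0 <= u m) ->
  \sum_(1 <= m <oo) u m = \sum_(m <oo) u m.+1.
Proof.
move=> u0; pose u' m := if (m == 0)%N then 0 else u m.
transitivity (\sum_(1 <= m <oo) u' m).
  apply/congr_lim/funext => n; apply: eq_big_nat => m /andP[m1 _].
  by rewrite /u' gtn_eqF.
rewrite -nneseries_addn.
  by apply/congr_lim/funext => n; apply: eq_bigr => m _; rewrite /u' addn1.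
by move=> [|m]; rewrite /u'//= u0.
Qed.

Lemma ge_cst_nneseries_pinfty u (c : R) : (0 < c)%R ->
  (forall k, c%:E <= u k) -> \sum_(k <oo) u k = +oo.
Proof.
move=> c0 cu; apply/eqyP => A A0.
have [n An] : exists n, (A <= c *+ n)%R.
  exists (Num.truncn (A / c)).+1.
  rewrite -mulr_natr mulrC -ler_pdivrMr// ltW//.
  by rewrite truncnS_gt.
have u0 k : 0 <= u k by rewrite (le_trans _ (cu k))// lee_fin ltW.
apply: (@le_trans _ _ (\sum_(0 <= k < n) u k)); last exact: nneseries_lim_ge.
apply: (@le_trans _ _ (\sum_(0 <= k < n) c%:E)); last exact: lee_sum.
by rewrite sumEFin lee_fin sumr_const_nat subn0.
Qed.

Lemma geometric_nneseries_half (c : R) :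
  \sum_(k <oo) (c / (2 ^ k.+1)%:R)%:E = c%:E.
Proof.
have := @cvg_geometric_eseries_half R c 0.
rewrite expr0 divr1 => /cvg_lim <- //.
by apply/congr_lim/funext => n; apply: eq_bigr => k _; rewrite addn1.
Qed.

(** The index shifts reflect that families of portfolios are numbered from 1,
    while [e] enumerates all pairs of naturals. *)
Lemma nneseries_pairing (e : nat -> nat * nat) F :
  set_bij setT setT e -> (forall k m, (1 <= m)%N -> 0 <= F k m) ->
  \sum_(1 <= p <oo) F (e p.-1).1 (e p.-1).2.+1 =
  \sum_(k <oo) \sum_(1 <= m <oo) F k m.
Proof.
move=> ebij F0; rewrite nneseries_from1; last by move=> *; exact: F0.
transitivity (\esum_(k in setT) \esum_(m in setT) F k m.+1); last first.
  rewrite nneseries_esumT; last by move=> k; apply: nneseries_ge0 => m *; exact: F0.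
  apply: eq_esum => k _; rewrite nneseries_from1; last by move=> *; exact: F0.
  by rewrite nneseries_esumT// => m; exact: F0.
rewrite esum_esum; last by move=> *; exact: F0.
have -> : [set: nat] `*`` (fun=> [set: nat]) = [set: nat * nat].
  by apply/seteqP; split.
rewrite (reindex_esum setT _ e) //= nneseries_esumT// => p; exact: F0.
Qed.

Lemma nneseries_from1_EFin (u : nat -> R) (s : R) :
  (forall m, (1 <= m)%N -> (0 <= u m)%R) ->
  series (fun m => u m.+1) @ \oo --> s ->
  \sum_(1 <= m <oo) (u m)%:E = s%:E.
Proof.
move=> u0 us; rewrite nneseries_from1; last by move=> m m1; rewrite lee_fin u0.
apply: cvg_lim => //; under eq_fun do rewrite sumEFin.
by apply: cvg_EFin; [exact: nearW|exact: us].
Qed.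

Lemma nneseries_from1_cvg (u : nat -> R) :
  (forall m, (1 <= m)%N -> (0 <= u m)%R) ->
  \sum_(1 <= m <oo) (u m)%:E < +oo ->
  exists s : R, series (fun m => u m.+1) @ \oo --> s.
Proof.
move=> u0; rewrite nneseries_from1; last by move=> m m1; rewrite lee_fin u0.
move=> ufin; exists (limn (series (fun m => u m.+1))).
by apply: nnseries_is_cvg => // m; exact: u0.
Qed.

End Series.

(** * Nodes, and portfolios restarted or stopped at a later time *)

Section Portfolios.
Set Implicit Arguments.
Unset Strict Implicit.
Context {R : realType}.
Implicit Types (S : trajectory R) (T A : set (trajectory R)).
Implicit Types (H : nat -> trajectory R -> R).

Lemma node_self T S j : T S -> node T S j S.
Proof. by []. Qed.

Lemma node_sub T S S' j k : (j <= k)%N ->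
  node T S j S' -> node T S' k `<=` node T S j.
Proof.
move=> jk [_ SS'] S'' [TS'' S'S'']; split => // i ij.
by rewrite S'S'' ?(leq_trans ij)// SS'.
Qed.

Lemma eq_node T S S' j : (forall i, (i <= j)%N -> S' i = S i) ->
  node T S' j = node T S j.
Proof.
by move=> SS'; apply/seteqP; split => S'' [TS'' E]; split => // i ij;
  rewrite E// SS'.
Qed.

Lemma portfolio_node T S S' j k H : (j <= k)%N -> node T S j S' ->
  portfolio (node T S j) j H -> portfolio (node T S' k) k H.
Proof.
move=> jk SS' pH i ki S1 S2 n1 n2 S12; apply: pH; first exact: leq_trans ki.
- exact: node_sub n1.
- exact: node_sub n2.
move=> l /andP[jl li]; have [kl|/ltnW lk] := leqP k l.
  by apply: S12; rewrite kl.
by rewrite n1.2// n2.2.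
Qed.

Lemma wealth_id j (x : R) H S : wealth j j x H S = x.
Proof. by rewrite /wealth /gains big_geq// addr0. Qed.

Lemma wealthS j n (x : R) H S : (j <= n)%N ->
  wealth j n.+1 x H S = (wealth j n x H S + H n S * increment n S)%R.
Proof. by move=> jn; rewrite /wealth /gains big_nat_recr//= addrA. Qed.

Lemma wealth_cat j k n (x : R) H S : (j <= k <= n)%N ->
  wealth j n x H S = wealth k n (wealth j k x H S) H S.
Proof.
by move=> /andP[jk kn]; rewrite /wealth /gains (big_cat_nat jk kn)/= addrA.
Qed.

Lemma eq_wealth j n (x : R) H H' S :
  (forall i, (j <= i < n)%N -> H i S = H' i S) ->
  wealth j n x H S = wealth j n x H' S.
Proof.
move=> HH'; rewrite /wealth /gains; congr (_ + _)%R.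
by apply: eq_big_nat => i /HH' ->.
Qed.

Lemma wealth_node T S S' S'' j k (x : R) H :
  portfolio (node T S j) j H -> node T S j S' -> (j <= k)%N ->
  node T S' k S'' -> wealth j k x H S'' = wealth j k x H S'.
Proof.
move=> pH n' jk n''; rewrite /wealth /gains; congr (_ + _)%R.
apply: eq_big_nat => i /andP[ji ik]; rewrite /increment !n''.2//; last exact: ltnW.
congr (_ * _)%R; apply: pH => //; first exact: node_sub n''.
by move=> l /andP[_ li]; rewrite n''.2// (leq_trans li)// ltnW.
Qed.

(** The limit inferior only sees late times, and before time [k] all
    trajectories of the later node have the same wealth. *)
Lemma liminf_wealth_restart T S S' S'' j k (x : R) H :
  portfolio (node T S j) j H -> node T S j S' -> (j <= k)%N ->
  node T S' k S'' ->
  liminf_wealth j x H S'' = liminf_wealth k (wealth j k x H S') H S''.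
Proof.
move=> pH n' jk n''; apply: near_eq_limn_einf; exists k => // n /= kn.
by rewrite (@wealth_cat j k) ?jk// (wealth_node _ pH n' jk n'').
Qed.

Lemma admissibleP A j (x : R) H : admissible A j x H <->
  portfolio A j H /\
  forall n S, (j <= n)%N -> A S -> (0 <= wealth j n x H S)%R.
Proof.
split=> [[pH aH]|[pH wH]]; split=> // n.
  by move=> S jn; apply: (aH n jn).2.
by move=> jn; split=> [|S AS]; [exists x, H, n; split | exact: wH].
Qed.

Lemma admissible_restart T S S' j k (x : R) H : (j <= k)%N ->
  node T S j S' -> admissible (node T S j) j x H ->
  admissible (node T S' k) k (wealth j k x H S') H.
Proof.
move=> jk n' /admissibleP[pH wH]; apply/admissibleP; split.
  exact: portfolio_node pH.
move=> n S'' kn n''; rewrite -(wealth_node _ pH n' jk n'').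
rewrite -wealth_cat ?jk//; apply: wH; first exact: leq_trans kn.
exact: node_sub n''.
Qed.

(** Liquidating at time [k] freezes the wealth, which turns the wealth at a
    finite time into a limit inferior. *)
Definition stopped k H i S : R := if (i < k)%N then H i S else 0%R.

(** The condition on [H] stops at time [k] in order to cover strategies that
    are non-anticipative on a finite horizon only. *)
Lemma stopped_portfolio A j k H :
  (forall i, (j <= i < k)%N -> forall S S', A S -> A S' ->
    (forall l, (j <= l <= i)%N -> S l = S' l) -> H i S = H i S') ->
  portfolio A j (stopped k H).
Proof.
move=> pH i ji S S' AS AS' SS'; rewrite /stopped; case: ifPn => // ik.
by apply: pH; rewrite ?ji.
Qed.

Lemma wealth_stopped j k n (x : R) H S : (j <= k)%N -> (j <= n)%N ->
  wealth j n x (stopped k H) S = wealth j (minn k n) x H S.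
Proof.
move=> jk jn; rewrite (@wealth_cat j (minn k n)) ?leq_min ?jk ?jn ?geq_minr//.
rewrite {1}/wealth /gains big_nat big1 ?addr0; last first.
  move=> i /andP[]; rewrite geq_min => + ilt.
  by rewrite /stopped [(n <= i)%N]leqNgt ilt orbF => /leq_gtF ->; rewrite mul0r.
by apply: eq_wealth => i /andP[_]; rewrite leq_min /stopped => /andP[->].
Qed.

Lemma liminf_wealth_stopped j k (x : R) H S : (j <= k)%N ->
  liminf_wealth j x (stopped k H) S = (wealth j k x H S)%:E.
Proof.
move=> jk; rewrite /liminf_wealth.
rewrite (@near_eq_limn_einf _ _ (fun=> (wealth j k x H S)%:E)); last first.
  exists k => // n /= kn.
  by rewrite wealth_stopped// ?(leq_trans jk)// (minn_idPl kn).
by apply: (cvg_limn_einf_sup _).1; exact: cvg_cst.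
Qed.

Lemma admissible_stopped A j k (x : R) H : (j <= k)%N ->
  admissible A j x H -> admissible A j x (stopped k H).
Proof.
move=> jk /admissibleP[pH wH]; apply/admissibleP; split.
  by apply: stopped_portfolio => i /andP[ji _]; exact: pH.
by move=> n S jn AS; rewrite wealth_stopped// wH// leq_min jk.
Qed.

Lemma liminf_wealth_ge0 A j (x : R) H S :
  admissible A j x H -> A S -> 0 <= liminf_wealth j x H S.
Proof.
move=> /admissibleP[_ wH] AS; rewrite /liminf_wealth limn_einf_lim.
apply: lime_ge; first exact: is_cvg_einfs.
exists j => // n /= jn; apply: le_ereal_inf_tmp => _ [m /= nm <-].
by rewrite lee_fin wH// (leq_trans jn).
Qed.

Lemma admissible_ge0 A j (x : R) H S : admissible A j x H -> A S -> (0 <= x)%R.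
Proof.
by move=> /admissibleP[_ /(_ j S (leqnn j))] + AS => /(_ AS); rewrite wealth_id.
Qed.

End Portfolios.

(** * Families of admissible portfolios and null sets *)

Section NullSets.
Set Implicit Arguments.
Unset Strict Implicit.
Context {R : realType}.
Implicit Types (S : trajectory R) (T A E N : set (trajectory R)).
Implicit Types (V : nat -> R) (H : nat -> nat -> trajectory R -> R).

Definition admissible_family A j V H :=
  forall m, (1 <= m)%N -> admissible A j (V m) (H m).

Definition cost V : \bar R := \sum_(1 <= m <oo) (V m)%:E.

Definition payoff j V H S : \bar R :=
  \sum_(1 <= m <oo) liminf_wealth j (V m) (H m) S.

Definition wealth_family j k V H S : nat -> R :=
  fun m => wealth j k (V m) (H m) S.

(** Asking for the payoff [+oo], rather than 1, makes covers insensitive to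
    the values of a function on the covered set: adding a cover to a hedge
    repairs any failure there. *)
Definition cheaply_covered A j E (eps : R) := exists V H,
  [/\ admissible_family A j V H, cost V <= eps%:E &
      forall S, A S -> E S -> payoff j V H S = +oo].

Lemma cost_ge0 A j V H S : admissible_family A j V H -> A S -> 0 <= cost V.
Proof.
move=> aH AS; apply: nneseries_ge0 => m m1 _.
by rewrite lee_fin; exact: admissible_ge0 (aH m m1) AS.
Qed.

Lemma payoff_ge0 A j V H S :
  admissible_family A j V H -> A S -> 0 <= payoff j V H S.
Proof.
move=> aH AS; apply: nneseries_ge0 => m m1 _.
exact: liminf_wealth_ge0 (aH m m1) AS.
Qed.

Lemma family_restart T S S' j k V H : (j <= k)%N -> node T S j S' ->
  admissible_family (node T S j) j V H ->
  admissible_family (node T S' k) k (wealth_family j k V H S') H.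
Proof. by move=> jk n' aH m m1; exact: admissible_restart n' (aH m m1). Qed.

Lemma payoff_restart T S S' S'' j k V H : (j <= k)%N -> node T S j S' ->
  admissible_family (node T S j) j V H -> node T S' k S'' ->
  payoff j V H S'' = payoff k (wealth_family j k V H S') H S''.
Proof.
move=> jk n' aH n''; apply/congr_lim/funext => n.
apply: eq_big_nat => m /andP[m1 _].
exact: liminf_wealth_restart (aH m m1).1 n' jk n''.
Qed.

Lemma payoff_stopped j k V H S : (j <= k)%N ->
  payoff j V (fun m => stopped k (H m)) S = cost (wealth_family j k V H S).
Proof.
move=> jk; apply/congr_lim/funext => n.
by apply: eq_bigr => m _; rewrite liminf_wealth_stopped.
Qed.

(** Countable subadditivity of the cost: countably many countable families,
    with geometrically decreasing costs, are relabelled as a single one. *)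
Lemma pack_families A j (eps : R) (V : nat -> nat -> R)
    (H : nat -> nat -> nat -> trajectory R -> R) :
  (exists S, A S) -> (forall k, admissible_family A j (V k) (H k)) ->
  (forall k, cost (V k) <= (eps / (2 ^ k.+1)%:R)%:E) ->
  exists V' H', [/\ admissible_family A j V' H', cost V' <= eps%:E &
    forall S, A S -> payoff j V' H' S = \sum_(k <oo) payoff j (V k) (H k) S].
Proof.
move=> [S0 AS0] aH cV.
have /card_set_bijP[e ebij] : ([set: nat] #= [set: nat * nat])%card.
  by rewrite card_eq_sym; exact: card_nat2.
exists (fun p => V (e p.-1).1 (e p.-1).2.+1), (fun p => H (e p.-1).1 (e p.-1).2.+1).
split=> [m m1||S AS]; first exact: aH.
- rewrite /cost (nneseries_pairing (F := fun k m => (V k m)%:E) ebij).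
    rewrite -geometric_nneseries_half; apply: lee_nneseries => [k _ _|k _].
      exact: cost_ge0 (aH k) AS0.
    exact: cV.
  by move=> k m m1; rewrite lee_fin; exact: admissible_ge0 (aH k m m1) AS0.
- apply: (nneseries_pairing
    (F := fun k m => liminf_wealth j (V k m) (H k m) S) ebij) => k m m1.
  exact: liminf_wealth_ge0 (aH k m m1) AS.
Qed.

Lemma cheaply_covered_bigcup A j (E : nat -> set (trajectory R)) (eps : R) :
  (exists S, A S) ->
  (forall k, cheaply_covered A j (E k) (eps / (2 ^ k.+1)%:R)) ->
  cheaply_covered A j (\bigcup_k E k) eps.
Proof.
move=> A0 cE.
have /choice[F FP] : forall k,
    exists F : (nat -> R) * (nat -> nat -> trajectory R -> R),
    [/\ admissible_family A j F.1 F.2, cost F.1 <= (eps / (2 ^ k.+1)%:R)%:E &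
        forall S, A S -> E k S -> payoff j F.1 F.2 S = +oo].
  by move=> k; have [V [H VH]] := cE k; exists (V, H).
have aF k : admissible_family A j (F k).1 (F k).2 by have [] := FP k.
have cF k : cost (F k).1 <= (eps / (2 ^ k.+1)%:R)%:E by have [] := FP k.
have [V [H [aH cV pH]]] := pack_families A0 aF cF.
exists V, H; split=> //.
move=> S AS [k _ EkS]; rewrite pH//; apply: (nneseries_pinfty _ (k := k)) => //.
  by move=> l _; exact: payoff_ge0 (aF l) AS.
by have [_ _ ->] := FP k.
Qed.

(** Countably many covers with payoff at least 1, bought together, pay [+oo]. *)
Lemma super_nullP T E : (exists S, T S) ->
  super_null T E <->
  E `<=` T /\ forall eps : R, (0 < eps)%R -> cheaply_covered T 0 E eps.
Proof.
move=> T0; split=> [[ET IE0]|[ET cE]]; split=> //.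
  move=> eps eps0.
  have /choice[F FP] : forall k,
    exists F : (nat -> R) * (nat -> nat -> trajectory R -> R),
      [/\ admissible_family T 0 F.1 F.2, cost F.1 <= (eps / (2 ^ k.+1)%:R)%:E &
          forall S, T S -> (\1_E S)%:E <= payoff 0 F.1 F.2 S].
    move=> k.
    have : Ibar0 T (fun S => (\1_E S)%:E) < (eps / (2 ^ k.+1)%:R)%:E.
      by rewrite IE0 lte_fin divr_gt0// ltr0n expn_gt0.
    move=> /ereal_inf_lt[x [V [H [aH EH ->]]]] /ltW lteps.
    by exists (V, H).
  have aF k : admissible_family T 0 (F k).1 (F k).2 by have [] := FP k.
  have cF k : cost (F k).1 <= (eps / (2 ^ k.+1)%:R)%:E by have [] := FP k.
  have [V [H [aH cV pH]]] := pack_families T0 aF cF.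
  exists V, H; split=> //.
  move=> S TS ES; rewrite pH//; apply: (@ge_cst_nneseries_pinfty _ _ 1) => // k.
  by have [_ _ /(_ S TS)] := FP k; rewrite indicE mem_set.
apply/eqP; rewrite eq_le; apply/andP; split.
  apply/lee_addgt0Pr => eps eps0; rewrite add0e.
  have [V [H [aH cV pH]]] := cE _ eps0.
  apply: le_trans cV; apply: ereal_inf_lbound.
  exists V, H; split=> // S TS.
  have [ES|nES] := pselect (E S); first by rewrite -/(payoff 0 V H S) pH// leey.
  by rewrite indicE memNset//; exact: payoff_ge0 aH TS.
apply: le_ereal_inf_tmp => _ [V [H [aH _ ->]]].
by have [S TS] := T0; exact: cost_ge0 aH TS.
Qed.

Lemma super_null_sub T E N : (exists S, T S) ->
  N `<=` E -> super_null T E -> super_null T N.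
Proof.
move=> T0 NE /(super_nullP _ T0)[ET cE]; apply/(super_nullP _ T0); split.
  exact: subset_trans ET.
move=> eps /cE[V [H [aH cV pH]]]; exists V, H; split=> // S TS /NE.
exact: pH.
Qed.

Lemma super_null_bigcup T (E : nat -> set (trajectory R)) : (exists S, T S) ->
  (forall k, super_null T (E k)) -> super_null T (\bigcup_k E k).
Proof.
move=> T0 nE; apply/(super_nullP _ T0); split.
  by move=> S [k _ EkS]; apply: (nE k).1.
move=> eps eps0; apply: cheaply_covered_bigcup => // k.
have /(super_nullP _ T0)[_] := nE k; apply.
by rewrite divr_gt0// ltr0n expn_gt0.
Qed.

Lemma super_nullU T E N : (exists S, T S) ->
  super_null T E -> super_null T N -> super_null T (E `|` N).
Proof.
move=> T0 nE nN; rewrite -bigcup2E; apply: super_null_bigcup => // -[|[|k]]//=.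
by apply: super_null_sub nE => // S [].
Qed.

(** The conditional form of null sets.  Buy covers [F k] of [E] of total cost
    [eps].  Restarted on the node of [S] at time [j], the cover [F k] costs its
    wealth at time [j].  If these wealths do not become arbitrarily small along
    [k], then their sum is [+oo], and this sum is the payoff at [S] of all the
    covers stopped at time [j]. *)
Lemma ae_cheaply_covered_node s0 T E j : (exists S, T S) ->
  trajectory_set s0 T -> super_null T E ->
  holds_ae T (fun S =>
    forall eps : R, (0 < eps)%R -> cheaply_covered (node T S j) j E eps).
Proof.
move=> T0 hT /(super_nullP _ T0)[ET cE]; apply/(super_nullP _ T0).
split=> [S []//|eps eps0].
have /choice[F FP] : forall k,
    exists F : (nat -> R) * (nat -> nat -> trajectory R -> R),
    [/\ admissible_family T 0 F.1 F.2, cost F.1 <= (eps / (2 ^ k.+1)%:R)%:E &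
        forall S, T S -> E S -> payoff 0 F.1 F.2 S = +oo].
  move=> k; have [|V [H VH]] := cE (eps / (2 ^ k.+1)%:R)%R.
    by rewrite divr_gt0// ltr0n expn_gt0.
  by exists (V, H).
have aF k : admissible_family T 0 (F k).1 (F k).2 by have [] := FP k.
pose G k m := stopped j ((F k).2 m).
have aG k : admissible_family T 0 (F k).1 (G k).
  by move=> m m1; apply: admissible_stopped => //; exact: aF.
have cF k : cost (F k).1 <= (eps / (2 ^ k.+1)%:R)%:E by have [] := FP k.
have [V [H [aH cV pH]]] := pack_families T0 aG cF.
exists V, H; split=> //.
move=> S TS [_ nS]; rewrite pH//.
have /existsNP[d /not_implyP[d0 nSd]] := nS.
apply: (ge_cst_nneseries_pinfty d0) => k; rewrite payoff_stopped//.
rewrite leNgt; apply/negP => /ltW cd; apply: nSd.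
have nSS : node T S 0 S by [].
have aFk : admissible_family (node T S 0) 0 (F k).1 (F k).2.
  by rewrite (node0 hT TS).
exists (wealth_family 0 j (F k).1 (F k).2 S), (F k).2; split => //.
  exact: family_restart aFk.
move=> S' nS' ES'; rewrite -(payoff_restart _ nSS aFk nS')//.
by have [_ _ ->] := FP k; case: nS'.
Qed.

(** Holding [c] units of the asset over the period from [i] to [i.+1], on the
    node of [S], cannot lose. *)
Definition one_sided T S i (c : R) :=
  forall S', node T S i S' -> (0 <= c * increment i S')%R.

(** Buying the riskless position [c] costs nothing, so countably many copies
    of it are still free, and they pay [+oo] wherever one copy gains. *)
Lemma one_sided_super_null s0 T i (c : R) : (exists S, T S) ->
  trajectory_set s0 T ->
  super_null T [set S | [/\ T S, one_sided T S i c & (0 < c * increment i S)%R]].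
Proof.
move=> T0 hT; apply/(super_nullP _ T0); split=> [S []//|eps eps0].
pose h k S := if (k == i) && `[< one_sided T S i c >] then c else 0%R.
have h0 k S : (k <= i)%N -> wealth 0 k 0 h S = 0%R.
  move=> ki; rewrite /wealth /gains big_nat big1 ?addr0// => l /andP[_ lk].
  by rewrite /h ltn_eqF ?mul0r// (leq_trans lk).
have hS S : wealth 0 i.+1 0 h S =
    (if `[< one_sided T S i c >] then c * increment i S else 0)%R.
  rewrite wealthS// h0// add0r /h eqxx /=.
  by case: ifP => _; rewrite ?mul0r.
have ah : admissible T 0 0%R (stopped i.+1 h).
  apply/admissibleP; split.
    apply: stopped_portfolio => k _ S S' TS TS' SS'.
    rewrite /h; case: eqP => //= ki; rewrite -ki /one_sided.
    by rewrite (@eq_node _ T S' S)// => l lk; rewrite SS'.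
  move=> n S _ TS; rewrite wealth_stopped//.
  have [ni|ni] := leqP i.+1 n.
    rewrite hS; case: asboolP => // /(_ S); apply; exact: node_self.
  by rewrite h0.
exists (fun=> 0%R), (fun=> stopped i.+1 h); split=> //.
  by rewrite /cost eseries0// lee_fin ltW.
move=> S TS [_ os pos].
rewrite /payoff nneseries_from1; last by move=> m _; exact: liminf_wealth_ge0 ah TS.
apply: (ge_cst_nneseries_pinfty pos) => k.
by rewrite liminf_wealth_stopped// lee_fin hS; case: asboolP.
Qed.

Lemma ae_mono T (P Q : trajectory R -> Prop) : (exists S, T S) ->
  (forall S, T S -> P S -> Q S) -> holds_ae T P -> holds_ae T Q.
Proof.
by move=> T0 PQ; apply: super_null_sub => // S [TS nQ]; split=> // /PQ; auto.
Qed.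

Lemma ae_and T (P Q : trajectory R -> Prop) : (exists S, T S) ->
  holds_ae T P -> holds_ae T Q -> holds_ae T (fun S => P S /\ Q S).
Proof.
move=> T0 aP aQ; apply: super_null_sub (super_nullU T0 aP aQ) => // S [TS nPQ].
have [PS|nPS] := pselect (P S); last by left.
by right; split=> // QS; apply: nPQ.
Qed.

Lemma ae_all T (P : nat -> trajectory R -> Prop) : (exists S, T S) ->
  (forall k, holds_ae T (P k)) -> holds_ae T (fun S => forall k, P k S).
Proof.
move=> T0 aP; apply: super_null_sub (super_null_bigcup T0 aP) => //.
by move=> S [TS /existsNP[k nPk]]; exists k.
Qed.

(** By property (L) the whole trajectory set is not null: a payoff [+oo]
    everywhere dominates the constant 2, hence costs at least 2. *)
Lemma ae_inhabited T (P : trajectory R -> Prop) : (exists S, T S) ->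
  property_L T 0 -> holds_ae T P -> exists S, T S /\ P S.
Proof.
move=> T0 L /(super_nullP _ T0)[_ cE]; apply: contrapT => nP.
have [V [H [aH cV pH]]] := cE _ (ltr01 (R := R)).
have : 2%:E <= cost V.
  apply: (L _ (fun _ => cst 0%R) 0%N _ _ _ _ aH) => // S TS.
  rewrite -/(payoff 0 V H S) pH ?leey//; split=> // PS; apply: nP.
  by exists S.
by move=> /le_trans/(_ cV); rewrite lee_fin; lra.
Qed.

(** The trajectory can move both up and down from its node at time [i]; with
    the case of a zero increment, these are the only nodes met outside a null
    set. *)
Definition two_sided T S i :=
  (exists2 S', node T S i S' & (0 < increment i S')%R) /\
  (exists2 S', node T S i S' & (increment i S' < 0)%R).

Lemma ae_two_sided s0 T : (exists S, T S) -> trajectory_set s0 T ->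
  holds_ae T (fun S => forall i, increment i S = 0%R \/ two_sided T S i).
Proof.
move=> T0 hT; apply: ae_all => // i.
have nU := super_nullU T0 (one_sided_super_null i 1 T0 hT)
  (one_sided_super_null i (-1) T0 hT).
apply: super_null_sub nU => // S [TS] /not_orP[/eqP i0 nts].
have [ip|im] := ltP 0%R (increment i S).
  left; split=> //; last by rewrite mul1r.
  move=> S' nS'; rewrite mul1r leNgt; apply/negP => nS'0; apply: nts.
  by split; [exists S|exists S'].
right; split=> //; last by rewrite mulN1r oppr_gt0 lt_neqAle i0.
move=> S' nS'; rewrite mulN1r oppr_ge0 leNgt; apply/negP => nS'0; apply: nts.
by split; [exists S'|exists S => //; rewrite lt_neqAle i0].
Qed.

End NullSets.

(** * From countable superhedges to finite-horizon portfolios *)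

Section Superhedging.
Set Implicit Arguments.
Unset Strict Implicit.
Context {R : realType}.
Implicit Types (S : trajectory R) (T A E N : set (trajectory R)).
Implicit Types (V : nat -> R) (H : nat -> nat -> trajectory R -> R).
Implicit Types (f : trajectory R -> \bar R).

(** Selling the elementary hedge [H0] from time [k] on leaves an elementary
    function on the later node, worth [c] minus the wealth already accumulated
    by [H0]; property (L) compares it with the restarted family. *)
Lemma property_L_bound T S S' j k (c x0 : R) (H0 : nat -> trajectory R -> R)
    n0 V H :
  node T S j S' -> (j <= k)%N -> (j <= n0)%N ->
  property_L (node T S' k) k -> portfolio (node T S j) j H0 ->
  admissible_family (node T S j) j V H ->
  (forall S'', node T S' k S'' ->
     c%:E <= (wealth j n0 x0 H0 S'')%:E + payoff j V H S'') ->
  c%:E <= (wealth j k x0 (stopped n0 H0) S')%:E + cost (wealth_family j k V H S').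
Proof.
move=> nS' jk jn0 L pH0 aH cle; set w := wealth j k x0 _ S'.
have pS : portfolio (node T S j) j (stopped n0 H0).
  by apply: stopped_portfolio => i /andP[ji _]; exact: pH0.
rewrite -leeBlDl// -EFinB.
apply: (L _ (fun i S => - stopped n0 H0 i S)%R (maxn n0 k) _ H).
- move=> i ki S1 S2 n1 n2 S12; congr (- _)%R.
  exact: (portfolio_node jk nS' pS).
- exact: leq_maxr.
- exact: family_restart nS' aH.
move=> S'' nS''; rewrite -/(payoff _ _ _ _) -(payoff_restart jk nS' aH nS'').
have -> : wealth k (maxn n0 k) (c - w) (fun i S => - stopped n0 H0 i S)%R S'' =
    (c - wealth j n0 x0 H0 S'')%R.
  have -> : wealth j n0 x0 H0 S'' = wealth k (maxn n0 k) w (stopped n0 H0) S''.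
    rewrite /w -(wealth_node _ pS nS' jk nS'') -wealth_cat ?jk ?leq_maxr//.
    by rewrite wealth_stopped ?(minn_idPl _)// leq_max ?jn0// leqnn.
  clearbody w; rewrite /wealth /gains opprD addrA; congr (_ + _)%R.
  by rewrite -sumrN; apply: eq_bigr => i _; rewrite mulNr.
by rewrite EFinB leeBlDl// cle.
Qed.

(** An admissible portfolio has to stay nonnegative after an upward and after
    a downward move; the two constraints bound its position from below and
    from above.  The constant depends on the two moves only, not on the
    portfolio. *)
Lemma position_le_wealth T S S' i j :
  node T S j S' -> (j <= i)%N -> two_sided T S' i ->
  exists C : R, forall x h, admissible (node T S j) j x h ->
    (`|h i S'| <= C * wealth j i x h S')%R.
Proof.
move=> nS' ji [[Su nSu u0] [Sd nSd d0]].
exists ((increment i Su)^-1 + (- increment i Sd)^-1)%R => x h ah.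
have [ph wh] := (admissibleP _ _ _ _).1 ah.
have key S'' : node T S' i S'' ->
    (0 <= wealth j i x h S' + h i S' * increment i S'')%R.
  move=> nS''; rewrite -(wealth_node _ ph nS' ji nS'').
  rewrite (_ : h i S' = h i S''); last first.
    apply: ph => //; first exact: node_sub nS''.
    by move=> k /andP[_ ki]; rewrite nS''.2.
  rewrite -wealthS//; apply: wh; first exact: leqW.
  exact: node_sub nS''.
have w0 : (0 <= wealth j i x h S')%R by exact: wh.
have ku := key _ nSu; have kd := key _ nSd.
move: (wealth _ _ _ _ _) w0 ku kd => w w0 ku kd.
have lu : (- h i S' <= w * (increment i Su)^-1)%R.
  by rewrite ler_pdivlMr//; lra.
have ld : (h i S' <= w * (- increment i Sd)^-1)%R.
  by rewrite ler_pdivlMr ?oppr_gt0//; lra.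
have pu : (0 <= w * (increment i Su)^-1)%R by rewrite mulr_ge0// invr_ge0 ltW.
have pd : (0 <= w * (- increment i Sd)^-1)%R.
  by rewrite mulr_ge0// invr_ge0 oppr_ge0 ltW.
by rewrite ler_norml; apply/andP; split; lra.
Qed.

(** The limit is meaningful only where the positions are summable; elsewhere
    the default value of [limn] is harmless because it still depends on the
    positions alone, so that the sum stays non-anticipative. *)
Definition summed_position H i S : R := limn (series (fun m => H m.+1 i S)).

(** Summability propagates in time: the positions are dominated by wealths
    that are already known to be summable. *)
Lemma cvg_series_wealth T S S' j n V H (s : R) :
  node T S j S' -> (j <= n)%N ->
  admissible_family (node T S j) j V H ->
  (forall i, increment i S' = 0%R \/ two_sided T S' i) ->
  series (fun m => V m.+1) @ \oo --> s ->
  series (fun m => wealth j n (V m.+1) (H m.+1) S') @ \oo -->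
    wealth j n s (summed_position H) S'.
Proof.
move=> nS' jn aH ts Vs; elim: n jn => [|n ih].
  rewrite leqn0 => /eqP ->; rewrite wealth_id.
  by under eq_fun do rewrite wealth_id.
rewrite leq_eqVlt => /predU1P[<-|].
  by rewrite wealth_id; under eq_fun do rewrite wealth_id.
rewrite ltnS => jn; move: (ih jn) => {}ih.
rewrite wealthS//; under eq_fun do rewrite wealthS//.
have [->|tsn] := ts n.
  by rewrite mulr0 addr0; under eq_fun do rewrite mulr0 addr0.
have [C CP] := position_le_wealth nS' jn tsn.
have cH : cvgn (series (fun m => H m.+1 n S')).
  apply: normed_cvg.
  apply: (@series_le_cvg _ _ (C *: (fun m => wealth j n (V m.+1) (H m.+1) S'))) => //.
  - by move=> m; exact: normr_ge0.
  - by move=> m; exact: le_trans (normr_ge0 _) (CP _ _ (aH m.+1 isT)).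
  - by move=> m; exact: CP (aH m.+1 isT).
  - by apply: is_cvg_seriesZ; apply/cvg_ex; exists (wealth j n s (summed_position H) S').
have -> : (fun m => wealth j n (V m.+1) (H m.+1) S' + H m.+1 n S' * increment n S')%R =
    ((fun m => wealth j n (V m.+1) (H m.+1) S') +
     increment n S' *: (fun m => H m.+1 n S'))%R.
  by apply/funext => m /=; rewrite [X in (_ + X)%R]mulrC.
rewrite seriesD seriesZ; apply: cvgD => //.
rewrite mulrC; apply: cvgZr; exact: cH.
Qed.

Definition superhedges A j f (x : \bar R) V H n0 :=
  [/\ portfolio A j (H 0%N) /\ (j <= n0)%N, admissible_family A j V H,
      forall S, A S ->
        f S <= (wealth j n0 (V 0%N) (H 0%N) S)%:E + payoff j V H S
    & (V 0%N)%:E + cost V <= x].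

Lemma sigmaop_le A j f (x : \bar R) V H n0 :
  superhedges A j f x V H n0 -> sigmaop A j f <= x.
Proof.
move=> [p0 aH fle cle]; apply: le_trans cle; apply: ereal_inf_lbound.
by exists V, H, n0; split.
Qed.

Lemma superhedges_exists A j f (eps : R) : (0 < eps)%R ->
  sigmaop A j f \is a fin_num ->
  exists V H n0, superhedges A j f (sigmaop A j f + eps%:E) V H n0.
Proof.
move=> eps0 sfin.
have [_ [V [H [n0 [p0 aH fle ->]]]] /ltW xlt] := lb_ereal_inf_adherent eps0 sfin.
by exists V, H, n0; split.
Qed.

(** Property (L) at the very node where the superhedging price is computed
    forbids a hedge of [c] for less than [c]. *)
Lemma sigmabar_ge T S j f (c : R) : T S -> property_L (node T S j) j ->
  (forall S', T S' -> c%:E <= f S') -> c%:E <= sigmabar T j f S.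
Proof.
move=> TS L cf; apply: le_ereal_inf_tmp => _ [V [H [n0 [[p0 jn0] aH fle ->]]]].
have nSS : node T S j S by [].
have := property_L_bound (x0 := V 0%N) nSS (leqnn j) jn0 L p0 aH.
rewrite wealth_id (_ : wealth_family j j V H S = V); last first.
  by apply/funext => m; rewrite /wealth_family wealth_id.
apply=> S' nS'; apply: le_trans (fle _ nS'); apply: cf.
exact: nS'.1.
Qed.

Lemma wealthD j n (x y : R) (g h : nat -> trajectory R -> R) S :
  (wealth j n x g S + wealth j n y h S =
   wealth j n (x + y) (fun i S => g i S + h i S) S)%R.
Proof.
rewrite /wealth /gains addrACA -big_split/=; congr (_ + _)%R.
by apply: eq_bigr => i _; rewrite mulrDl.
Qed.

Definition finite_horizon_hedge n0 H i S : R :=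
  (stopped n0 (H 0%N) i S + summed_position H i S)%R.

(** Every real [d] below the claim is compared with the wealth at time [k] by
    [property_L_bound]; going through such [d] also covers a claim that would
    be [+oo], which is thereby excluded. *)
Lemma superhedges_finite_horizon T S S' j k f (c x : R) V H n0 :
  node T S j S' -> (j <= k)%N -> has_maturity T k f ->
  (forall S'', T S'' -> c%:E <= f S'') ->
  property_L (node T S' k) k ->
  (forall i, increment i S' = 0%R \/ two_sided T S' i) ->
  superhedges (node T S j) j f x%:E V H n0 ->
  f S' <= (wealth j k x (finite_horizon_hedge n0 H) S')%:E.
Proof.
move=> nS' jk fk cf L ts [[p0 jn0] aH fle cle].
have V0 m : (1 <= m)%N -> (0 <= V m)%R.
  by move=> m1; exact: admissible_ge0 (aH m m1) nS'.
have [s Vs] : exists s : R, series (fun m => V m.+1) @ \oo --> s.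
  apply: nneseries_from1_cvg => //; rewrite -/(cost V).
  by rewrite -(@lteD2lE _ (V 0%N)%:E)// (le_lt_trans cle)// ltry.
have costE : cost V = s%:E by exact: nneseries_from1_EFin.
have W0 m : (1 <= m)%N -> (0 <= wealth_family j k V H S' m)%R.
  by move=> m1; apply: ((admissibleP _ _ _ _).1 (aH m m1)).2.
have wE : cost (wealth_family j k V H S') = (wealth j k s (summed_position H) S')%:E.
  exact: nneseries_from1_EFin W0 (cvg_series_wealth nS' jk aH ts Vs).
have TS' : T S' by exact: nS'.1.
have bound (d : R) : d%:E <= f S' ->
    (d <= wealth j k (V 0%N + s) (finite_horizon_hedge n0 H) S')%R.
  move=> df; rewrite -lee_fin -wealthD EFinD -wE.
  apply: (property_L_bound nS' jk jn0 L p0 aH) => S'' nS''.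
  apply: le_trans (fle _ (node_sub jk nS' nS'')).
  by rewrite -(fk S' S'' TS' nS'').
have xle : ((wealth j k (V 0%N + s) (finite_horizon_hedge n0 H) S')%:E
    <= (wealth j k x (finite_horizon_hedge n0 H) S')%:E).
  by rewrite lee_fin /wealth lerD2r -lee_fin EFinD -costE.
apply: le_trans xle; case fE : (f S') bound => [d| |] bound.
- by rewrite lee_fin bound.
- exfalso; move: bound; set w := wealth _ _ _ _ _ => /(_ (w + 1)%R).
  by rewrite leey => /(_ isT); lra.
- by rewrite leNye.
Qed.

(** The superhedge is chosen as a function of the node, seen as a set of
    trajectories; the zero portfolio is the default, so that the strategy is
    non-anticipative even where no near-optimal superhedge exists. *)
Lemma ae_superreplication T s0 j k f (c eps : R) :
  trajectory_set s0 T -> (exists S, T S) -> assumption_L_ae T ->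
  (j <= k)%N -> has_maturity T k f ->
  (forall S, T S -> c%:E <= f S) -> (0 < eps)%R ->
  exists h : nat -> trajectory R -> R, non_anticipative T j k h /\
    holds_ae T (fun S => f S <= (sigmabar T j f S + eps%:E) + (gains j k h S)%:E).
Proof.
move=> hT T0 [_ Lae] jk fk cf eps0.
pose hedge_of A (D : (nat -> R) * (nat -> nat -> trajectory R -> R) * nat) :=
  superhedges A j f (sigmaop A j f + eps%:E) D.1.1 D.1.2 D.2.
have /choice[D DP] : forall A, exists D,
    ((exists D', hedge_of A D') -> hedge_of A D) /\
    forall m, portfolio A j (D.1.2 m).
  move=> A; have [[D hD]|nD] := pselect (exists D, hedge_of A D).
    exists D; split=> // -[|m]; case: hD => [[p0 _] aH _ _] //.
    exact: (aH m.+1 isT).1.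
  by exists ((fun=> 0%R), (fun _ _ => fun=> 0%R), 0%N).
pose d S := D (node T S j).
exists (fun i S => finite_horizon_hedge (d S).2 (d S).1.2 i S); split.
  move=> i /andP[ji _] S S' TS TS' SS'.
  have nSS' : node T S' j = node T S j.
    by apply: eq_node => l lj; rewrite SS'// (leq_trans lj).
  rewrite /d nSS' /finite_horizon_hedge /stopped /summed_position.
  have HE m : (D (node T S j)).1.2 m i S = (D (node T S j)).1.2 m i S'.
    apply: (DP _).2 => //; first by rewrite -nSS'.
    by move=> l /andP[_ li]; exact: SS'.
  by rewrite HE; under eq_fun do rewrite HE.
have aL : holds_ae T (fun S => forall i, property_L (node T S i) i).
  by apply: super_null_sub Lae => // S [TS /existsNP nL].
apply: ae_mono (ae_and T0 aL (ae_two_sided T0 hT)) => // S TS [LS ts].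
have cs : c%:E <= sigmabar T j f S by exact: sigmabar_ge.
case sE : (sigmabar T j f S) cs => [r| |]// _; last by rewrite leey.
have hd : hedge_of (node T S j) (d S).
  apply: (DP _).1; have sfin : sigmaop (node T S j) j f \is a fin_num.
    by rewrite -/(sigmabar T j f S) sE.
  have [V [H [n0 h]]] := superhedges_exists eps0 sfin.
  by exists (V, H, n0).
move: hd; rewrite /hedge_of -/(sigmabar T j f S) sE -EFinD => hd.
have nSS : node T S j S by [].
rewrite -EFinD.
have := superhedges_finite_horizon nSS jk fk cf (LS k) ts hd.
by rewrite /wealth /gains.
Qed.

(** On a node with cheap covers of [N], the hedge [h] completed by a cover is a
    superhedge of the claim on the whole node. *)
Lemma ae_sigmabar_le T s0 j k f (V : trajectory R -> \bar R)
    (h : nat -> trajectory R -> R) N :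
  trajectory_set s0 T -> (exists S, T S) -> (j <= k)%N ->
  (forall S, T S -> -oo < f S) ->
  has_maturity T j V -> non_anticipative T j k h -> super_null T N ->
  (forall S, (T `\` N) S -> f S <= V S + (gains j k h S)%:E) ->
  holds_ae T (fun S => sigmabar T j f S <= V S).
Proof.
move=> hT T0 jk fNy Vj hna nN fle.
have aN : holds_ae T (fun S => ~ N S).
  by apply: super_null_sub nN => // S [_ /contrapT].
apply: ae_mono (ae_and T0 aN (ae_cheaply_covered_node j T0 hT nN)) => // S TS.
move=> [nNS cN]; case VE : (V S) => [r| |]; last 1 first.
(* V S = -oo would force f S = -oo *)
- have := fNy _ TS; rewrite ltNge => /negP; case.
  by have := fle S; rewrite VE/=; apply.
- (* slot 0 carries the hedge h, the other slots the cover of N *)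
  apply/lee_addgt0Pr => eps eps0; have [W [H [aH cW pH]]] := cN _ eps0.
  pose W' m := if m is m'.+1 then W m else r.
  pose H' m := if m is m'.+1 then H m else stopped k h.
  have costE : cost W' = cost W.
    apply/congr_lim/funext => n; apply: eq_big_nat => -[|m]//.
  have payoffE S' : payoff j W' H' S' = payoff j W H S'.
    apply/congr_lim/funext => n; apply: eq_big_nat => -[|m]//.
  apply: (@sigmaop_le _ _ _ _ W' H' k); split.
  + split=> //; apply: stopped_portfolio => i ik S1 S2 [TS1 n1] [TS2 n2] S12.
    apply: hna => // l li; have [jl|/ltnW lj] := leqP j l.
      by apply: S12; rewrite jl.
    by rewrite n1// n2.
  + by move=> [|m]// m1; exact: aH.
  + move=> S' nS'; rewrite payoffE /= wealth_stopped// minnn.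
    have [NS'|nNS'] := pselect (N S'); first by rewrite pH// addey// leey.
    apply: (@le_trans _ _ (wealth j k r h S')%:E).
      rewrite /wealth EFinD -VE (Vj S S' TS nS'); apply: fle; split=> //.
      exact: nS'.1.
    by rewrite leeDl// (payoff_ge0 aH nS').
  + by rewrite costE /= leeD2l.
- by rewrite leey.
Qed.

End Superhedging.

Theorem theorem6p1 (R : realType) (s0 : R) (T : set (trajectory R))
    (hT : trajectory_set s0 T) (hL : assumption_L_ae T)
    (f : trajectory R -> \bar R) (nf : nat)
    (hf_mat : has_maturity T nf f) (hf_bnd : bounded_below T f)
    (hf_fin : sigmabar0 T f < +oo)
    (j : nat) (hj : (j < nf)%N) :
  [/\ (forall eps : R, (0 < eps)%R ->
        exists (N : set (trajectory R)) (H : nat -> trajectory R -> R),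
          [/\ super_null T N, non_anticipative T j nf H &
              forall S, (T `\` N) S ->
                f S <= (sigmabar T j f S + eps%:E) + (gains j nf H S)%:E]),
      (forall (V : trajectory R -> \bar R) (H : nat -> trajectory R -> R)
              (N : set (trajectory R)),
          has_maturity T j V -> non_anticipative T j nf H -> super_null T N ->
          (forall S, (T `\` N) S -> f S <= V S + (gains j nf H S)%:E) ->
          holds_ae T (fun S => sigmabar T j f S <= V S)) &
      sigmabar0 T f =
        ereal_inf [set x | exists V : R, x = V%:E /\
          exists H : nat -> trajectory R -> R,
            non_anticipative T 0 nf H /\
            holds_ae T (fun S => f S <= V%:E + (gains 0 nf H S)%:E)]].
Proof.
have [c cf] := hf_bnd.
(* on an empty set, (L) would bound the initial value 1 by the cost 0 *)
have T0 : exists S, T S.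
  apply: contrapT => /forallNP T0.
  suff : 1%:E <= \sum_(1 <= m <oo) (0%R : R)%:E by rewrite eseries0// lee_fin ler10.
  apply: (hL.1 _ (fun _ => cst 0%R) 0%N _ (fun _ _ => cst 0%R)) => // [m _|S /T0//].
  by split=> // n _; split=> [|S /T0//]; exists 0%R, (fun _ => cst 0%R), n.
have fNy S : T S -> -oo < f S.
  by move=> TS; rewrite (lt_le_trans _ (cf _ TS))// ltNyr.
split.
- move=> eps eps0.
  have [H [Hna aH]] := ae_superreplication hT T0 hL (ltnW hj) hf_mat cf eps0.
  eexists; exists H; split; [exact: aH | exact: Hna |].
  by move=> S [TS] /not_andP[]// /contrapT.
- move=> V H N Vj Hna nN fle.
  exact: (ae_sigmabar_le hT T0 (ltnW hj) fNy Vj Hna nN fle).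
- have [S0 TS0] := T0.
  have s0E S : T S -> sigmabar T 0 f S = sigmabar0 T f
    by move=> TS; exact: sigmabar_at0 hT TS.
  apply/eqP; rewrite eq_le; apply/andP; split.
    apply: le_ereal_inf_tmp => _ [V [-> [H [Hna aH]]]].
    have VT : has_maturity T 0 (fun=> V%:E) by [].
    have aV : holds_ae T (fun S => sigmabar T 0 f S <= V%:E).
      apply: (ae_sigmabar_le hT T0 (leq0n nf) fNy VT Hna aH) => S [TS].
      by move=> /not_andP[]// /contrapT.
    by have [S [TS]] := ae_inhabited T0 hL.1 aV; rewrite s0E.
  have cs : c%:E <= sigmabar0 T f.
    rewrite -(s0E _ TS0); apply: sigmabar_ge => //.
    by rewrite (node0 hT TS0); exact: hL.1.
  apply/lee_addgt0Pr => eps eps0.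
  have [H [Hna aH]] := ae_superreplication hT T0 hL (leq0n nf) hf_mat cf eps0.
  case sE : (sigmabar0 T f) cs hf_fin => [r| |]// _ _.
  apply: ereal_inf_lbound; exists (r + eps)%R; split; first by rewrite EFinD.
  exists H; split=> //; apply: ae_mono aH => // S TS.
  by rewrite s0E// sE EFinD.
Qed.
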